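(* Let $n,\alpha$ be positive integers, $\varepsilon\in(0,1)$ and $\beta\ge 1$. Suppose a dataset $S$ over the universe $[n]$ is distributed across $\alpha$ players and has $C=\beta\cdot O\left(\min\left(F_0(S),\frac{1}{\varepsilon^2}\right)\right)$ pairwise collisions. Then there exists a protocol that, with probability at least $\frac{2}{3}$, outputs a $(1+\varepsilon)$-approximation to $F_0(S)$ and uses \[O(\alpha\log n)+O\left(\min\left(F_0(S),\frac{1}{\varepsilon^2}\right)\right)\cdot\sqrt{\beta}\log n\] bits of communication.
   Context: Distributed distinct element estimation (coordinator model): there are $\alpha$ servers (players), one of which acts as coordinator; server $a$ holds a vector $v^{(a)}\in\{0,1\}^n$ (equivalently a subset of $[n]$), and $S$ denotes the union (multiset) of all items held by the servers. All communication goes between the coordinator and the other servers; the communication cost is the total number of bits exchanged in the worst case. $F_0(S)$ is the number of distinct elements of $S$, i.e., the number of $j\in[n]$ with $v^{(a)}_j=1$ for some $a$. The number of pairwise collisions is the number of triples $(a,b,i)$ with $1\le a<b\le\alpha$, $i\in[n]$ and $v^{(a)}_i=v^{(b)}_i=1$. A $(1+\varepsilon)$-approximation to a quantity $F$ is a value $\hat F$ with $(1-\varepsilon)F\le\hat F\le(1+\varepsilon)F$. *)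

(* Defs.v *)
From HB Require Import structures.
From mathcomp Require Import all_boot all_order all_algebra.
From mathcomp Require Import reals.
Set Implicit Arguments. Unset Strict Implicit. Unset Printing Implicit Defensive.
Import Order.TTheory GRing.Theory Num.Theory.
Local Open Scope ring_scope.

(* Server a holds v a, a subset of the universe [n] = 'I_n.                   *)
Definition F0 (alpha n : nat) (v : {ffun 'I_alpha -> {set 'I_n}}) : nat :=
  #|\bigcup_(a : 'I_alpha) v a|.

Definition collisions (alpha n : nat) (v : {ffun 'I_alpha -> {set 'I_n}}) : nat :=
  #|[set t : ('I_alpha * 'I_alpha) * 'I_n |
       [&& (t.1.1 < t.1.2)%N, t.2 \in v t.1.1 & t.2 \in v t.1.2]]|.

(* A message is one bit on the channel between the coordinator and a server:
   (server a, true = sent by a to the coordinator / false = sent by the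
   coordinator to a, the bit). *)
Definition msg (alpha : nat) : Type := ('I_alpha * bool * bool)%type.

Inductive action (alpha : nat) (O : Type) :=
| Stop of O
| CSend of 'I_alpha & bool
| Ask of 'I_alpha.

(* Each server has its own private random seed drawn uniformly from the
   finite type Rnd, independently of the others. *)
Record protocol (alpha n : nat) (O : Type) := Protocol {
  Rnd : finType;
  fuel : nat;
  coord_id : 'I_alpha;
  coord : {set 'I_n} -> Rnd -> seq (msg alpha) -> action alpha O;
  player : 'I_alpha -> {set 'I_n} -> Rnd -> seq (bool * bool) -> bool
}.

Definition local_view (alpha : nat) (a : 'I_alpha) (t : seq (msg alpha))
  : seq (bool * bool) :=
  [seq (m.1.2, m.2) | m <- t & m.1.1 == a].

Section Run.
Variables (alpha n : nat) (O : Type) (P : protocol alpha n O).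
Variables (v : {ffun 'I_alpha -> {set 'I_n}}) (r : {ffun 'I_alpha -> Rnd P}).

Fixpoint run_from (k : nat) (t : seq (msg alpha)) : option O * seq (msg alpha) :=
  match k with
  | 0 => (None, t)
  | k'.+1 =>
    match @coord _ _ _ P (v (coord_id P)) (r (coord_id P)) t with
    | Stop o => (Some o, t)
    | CSend a b => run_from k' (rcons t (a, false, b))
    | Ask a => run_from k'
                 (rcons t (a, true, @player _ _ _ P a (v a) (r a) (local_view a t)))
    end
  end.

Definition run : option O * seq (msg alpha) := run_from (fuel P) [::].

Definition cost : nat := size run.2.
End Run.

Definition prob (R : realType) (alpha n : nat) (O : Type) (P : protocol alpha n O)
  (E : pred {ffun 'I_alpha -> Rnd P}) : R :=
  (#|[set r | E r]|)%:R / (#|{ffun 'I_alpha -> Rnd P}|)%:R.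

Definition approx (R : realType) (eps : R) (F : R) (x : R) : bool :=
  ((1 - eps) * F <= x) && (x <= (1 + eps) * F).

Definition approx_out (R : realType) (eps : R) (F : R) (o : option R) : bool :=
  if o is Some x then approx eps F x else false.

(* log n, as the bit length of n (>= 1, so that O(alpha log n) is
   meaningful also for n = 1). *)
Definition logn2 (n : nat) : nat := (trunc_log 2 n).+1.

(* Main.v *)
(** The coordinator draws two seeds of a pairwise independent hash function
    x |-> a x + b over GF(q), n < q = 2^k with k = logn2 n, and broadcasts them.

    Under the first hash every server reports the least hash value of its set;
    the global minimum M satisfies q/(10 F0) < M + 1 <= 10 q/F0 with
    probability at least 1 - 19/90 (first moment below, Chebyshev above).

    Under the second hash every server reports those of its items whose hash
    value, counted from 1, is at most 91 (M+1)/eps^2.  The number of distinct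
    items reported has mean at least 9/eps^2 (unless everything is sampled), so by
    Chebyshev it estimates F0 up to 1 + eps, with failure probability at most 1/9.

    To keep the cost small in the worst case, the coordinator aborts once it has
    seen more than 1820/eps^2 distinct items; the set D of items seen then has
    size O(min(F0, 1/eps^2)).  An item held by k servers is sent at most k times,
    and with b = sqrt beta one has k <= 3 b + 'C(k, 2) / b, so that at most
    3 b |D| + C / b = O(b min(F0, 1/eps^2)) items are sent in total. *)
Require Import Defs.
From HB Require Import structures.
From mathcomp Require Import all_boot all_order all_algebra all_field.
From mathcomp Require Import reals.
From mathcomp Require Import zify ring lra.
Import Order.TTheory GRing.Theory Num.Theory.
Local Open Scope ring_scope.
Set Implicit Arguments.
Unset Strict Implicit.
Unset Printing Implicit Defensive.

(** * Coordinator strategies as decision trees *)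

Section Codec.
Local Open Scope nat_scope.
Variable T : eqType.

(** The code of [x] is the [w]-bit word of the same rank as [x] in [A]; the default [nseq w false]
    keeps the length at [w] even if there is no such word. *)
Definition encode (A : seq T) (w : nat) (x : T) : bitseq :=
  nth (nseq w false) [seq val u | u <- enum {: w.-tuple bool}] (index x A).

Definition decode (x0 : T) (A : seq T) (w : nat) (b : bitseq) : T :=
  nth x0 A (index b [seq val u | u <- enum {: w.-tuple bool}]).

Lemma size_encode A w x : size (encode A w x) = w.
Proof.
rewrite /encode; set us := [seq _ | _ <- _].
have [lt|ge] := ltnP (index x A) (size us); last by rewrite nth_default ?size_nseq.
by have /mapP[u _ ->] := mem_nth (nseq w false) lt; rewrite size_tuple.
Qed.

Lemma encodeK x0 A w x : x \in A -> size A <= 2 ^ w ->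
  decode x0 A w (encode A w x) = x.
Proof.
move=> xA sA; rewrite /decode /encode index_uniq ?nth_index //.
  rewrite size_map -cardE card_tuple card_bool.
  by rewrite (leq_trans _ sA) ?index_mem.
by rewrite map_inj_uniq ?enum_uniq //; apply: val_inj.
Qed.
End Codec.

Section Tree.
Local Open Scope nat_scope.
Variables (alpha : nat) (O : Type).

(** Continuations carry what the coordinator has learnt so far, which [coord] has to recompute from
    the transcript. *)
Inductive tree :=
| Leaf of O
| SendT of 'I_alpha & bool & tree
| AskT of 'I_alpha & (bool -> tree).

Fixpoint depth (tr : tree) : nat :=
  match tr with
  | Leaf _ => 0
  | SendT _ _ tr' => (depth tr').+1
  | AskT _ k => (maxn (depth (k true)) (depth (k false))).+1
  end.

(* The action of the coordinator after the transcript t, t being consistent with tr. *)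
Fixpoint follow (tr : tree) (t : seq (msg alpha)) : action alpha O :=
  match tr, t with
  | Leaf o, _ => Stop alpha o
  | SendT a b _, [::] => CSend O a b
  | AskT a _, [::] => Ask O a
  | SendT _ _ tr', _ :: t' => follow tr' t'
  | AskT _ k, m :: t' => follow (k m.2) t'
  end.

Definition extend (vw : {ffun 'I_alpha -> bitseq}) (a : 'I_alpha) (w : bitseq) :
  {ffun 'I_alpha -> bitseq} := [ffun a' => if a' == a then vw a' ++ w else vw a'].

Implicit Type vw : {ffun 'I_alpha -> bitseq}.
Variable g : 'I_alpha -> bitseq -> bool.

(* Output and number of bits exchanged, when vw a lists the bits exchanged so
   far with server a and g a computes its next answer. *)
Fixpoint eval (tr : tree) (vw : {ffun 'I_alpha -> bitseq}) : O * nat :=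
  match tr with
  | Leaf o => (o, 0)
  | SendT a b tr' => let e := eval tr' (extend vw a [:: b]) in (e.1, e.2.+1)
  | AskT a k => let b := g a (vw a) in
      let e := eval (k b) (extend vw a [:: b]) in (e.1, e.2.+1)
  end.

Definition sendW (a : 'I_alpha) (w : bitseq) (tr : tree) : tree := foldr (SendT a) tr w.

Fixpoint askW (a : 'I_alpha) (m : nat) (k : bitseq -> tree) : tree :=
  if m is m'.+1 then AskT a (fun b => askW a m' (fun w => k (b :: w))) else k [::].

Lemma extend_nil vw a : extend vw a [::] = vw.
Proof. by apply/ffunP => a'; rewrite ffunE cats0 if_same. Qed.

Lemma extend_cat vw a w1 w2 : extend (extend vw a w1) a w2 = extend vw a (w1 ++ w2).
Proof. by apply/ffunP => a'; rewrite !ffunE; case: eqP => // _; rewrite catA. Qed.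

Lemma eval_sendW a w tr vw :
  eval (sendW a w tr) vw = ((eval tr (extend vw a w)).1, (eval tr (extend vw a w)).2 + size w).
Proof.
elim: w vw => [|b w IHw] vw /=; first by rewrite extend_nil addn0 -surjective_pairing.
by rewrite IHw extend_cat /= addnS.
Qed.

Lemma eval_askW a m w k vw : size w = m ->
  (forall i, i < m -> g a (vw a ++ take i w) = nth false w i) ->
  eval (askW a m k) vw =
    ((eval (k w) (extend vw a w)).1, (eval (k w) (extend vw a w)).2 + m).
Proof.
move=> <-; elim: w k vw => [|b w IHw] k vw gw /=.
  by rewrite extend_nil addn0 -surjective_pairing.
have -> : g a (vw a) = b by have := gw 0 erefl; rewrite cats0.
rewrite IHw ?extend_cat /= ?addnS // => i lti.
by rewrite ffunE eqxx -catA; apply: (gw i.+1).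
Qed.

Definition broadcast (w : bitseq) (l : seq 'I_alpha) (tr : tree) : tree :=
  foldr (fun a => sendW a w) tr l.

Fixpoint gather (m : nat) (l : seq 'I_alpha) (k : seq bitseq -> tree) : tree :=
  if l is a :: l' then askW a m (fun w => gather m l' (fun ws => k (w :: ws)))
  else k [::].

Lemma extend_cons (F : 'I_alpha -> bitseq) vw a l : a \notin l ->
  [ffun a' => if a' \in l then extend vw a (F a) a' ++ F a' else extend vw a (F a) a']
  = [ffun a' => if a' \in a :: l then vw a' ++ F a' else vw a'].
Proof.
move=> al; apply/ffunP => a'; rewrite !ffunE inE.
by case: eqP => [->|//]; rewrite (negPf al).
Qed.

Lemma eval_broadcast_seq w l tr vw : uniq l ->
  let e := eval tr [ffun a => if a \in l then vw a ++ w else vw a] in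
  eval (broadcast w l tr) vw = (e.1, e.2 + size l * size w).
Proof.
elim: l vw => [|a l IHl] vw /= => [_|/andP[al ul]].
  rewrite addn0 -surjective_pairing; congr eval.
  by apply/ffunP => a; rewrite ffunE.
by rewrite eval_sendW IHl //= (extend_cons (fun=> w)) // mulSn addnA addnAC.
Qed.

Lemma eval_broadcast w tr vw :
  let e := eval tr [ffun a => vw a ++ w] in
  eval (broadcast w (enum 'I_alpha) tr) vw = (e.1, e.2 + alpha * size w).
Proof.
rewrite eval_broadcast_seq ?enum_uniq // size_enum_ord.
have -> // : [ffun a => if a \in enum 'I_alpha then vw a ++ w else vw a]
  = [ffun a => vw a ++ w] :> {ffun 'I_alpha -> bitseq}.
by apply/ffunP => a; rewrite !ffunE mem_enum.
Qed.

Lemma eval_gather_seq m (F : 'I_alpha -> bitseq) l k vw : uniq l ->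
  (forall a, a \in l -> size (F a) = m) ->
  (forall a i, a \in l -> i < m -> g a (vw a ++ take i (F a)) = nth false (F a) i) ->
  let e := eval (k (map F l)) [ffun a => if a \in l then vw a ++ F a else vw a] in
  eval (gather m l k) vw = (e.1, e.2 + size l * m).
Proof.
elim: l k vw => [|a l IHl] k vw /= => [_ _ _|/andP[al ul] sF gF].
  rewrite addn0 -surjective_pairing; congr eval.
  by apply/ffunP => a; rewrite ffunE.
rewrite (eval_askW (w := F a)) => [||i]; last by apply: gF; rewrite mem_head.
  2: by apply: sF; rewrite mem_head.
rewrite IHl //= => [|a' a'l|a' i a'l im].
- by rewrite (extend_cons F) // mulSn addnA addnAC.
- by apply: sF; rewrite inE a'l orbT.
rewrite ffunE ifN; last by apply: contraNneq al => <-.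
by apply: gF; rewrite // inE a'l orbT.
Qed.

Lemma eval_gather m (F : 'I_alpha -> bitseq) k vw :
  (forall a, size (F a) = m) ->
  (forall a i, i < m -> g a (vw a ++ take i (F a)) = nth false (F a) i) ->
  let e := eval (k (map F (enum 'I_alpha))) [ffun a => vw a ++ F a] in
  eval (gather m (enum 'I_alpha) k) vw = (e.1, e.2 + alpha * m).
Proof.
move=> sF gF; rewrite (eval_gather_seq (F := F)) ?enum_uniq ?size_enum_ord //; last first.
  by move=> a i _; apply: gF.
have -> // : [ffun a => if a \in enum 'I_alpha then vw a ++ F a else vw a]
  = [ffun a => vw a ++ F a] :> {ffun 'I_alpha -> bitseq}.
by apply/ffunP => a; rewrite !ffunE mem_enum.
Qed.
End Tree.

(** * From trees to protocols *)

Section TreeProtocol.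
Local Open Scope nat_scope.
Variables (alpha n : nat) (O : Type) (T : finType) (c : 'I_alpha).
Variables (tr : T -> tree alpha O) (pl : {set 'I_n} -> bitseq -> bool).

(** All randomness comes from the seed of [c], whose own set enters through its role as a player.
    The extra unit of fuel is for the final [Stop]. *)
Definition tree_protocol : protocol alpha n O :=
  @Protocol alpha n O T (\max_x depth (tr x)).+1 c
    (fun _ x t => follow (tr x) t) (fun _ S _ lv => pl S (unzip2 lv)).

Variables (v : {ffun 'I_alpha -> {set 'I_n}}) (r : {ffun 'I_alpha -> T}).

(** Invariant of a run: after the transcript [t0] the strategy that remains is [tr0]; fuel above its
    depth ensures that a [Leaf] is reached. *)
Lemma run_from_tree k t0 tr0 :
  depth tr0 < k -> (forall t, follow (tr (r c)) (t0 ++ t) = follow tr0 t) ->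
  let e := eval (fun a => pl (v a)) tr0 [ffun a => unzip2 (local_view a t0)] in
  let f := @run_from alpha n O tree_protocol v r k t0 in
  f.1 = Some e.1 /\ size f.2 = size t0 + e.2.
Proof.
elim: k t0 tr0 => [//|k IHk] t0 tr0 dk ft0 /=.
have step a d b :
    [ffun a' => unzip2 (local_view a' (rcons t0 (a, d, b)))]
    = extend [ffun a' => unzip2 (local_view a' t0)] a [:: b].
  apply/ffunP => a'; rewrite !ffunE /local_view filter_rcons /= eq_sym.
  by case: eqP; rewrite // map_rcons /unzip2 map_rcons cats1.
rewrite -[t0 in follow _ t0]cats0 ft0; case: tr0 dk ft0 => [o|a b tr1|a k1] /= dk ft0.
- by rewrite addn0.
- have [t|] := IHk (rcons t0 (a, false, b)) tr1 dk; first by rewrite cat_rcons ft0.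
  by rewrite step => -> ->; rewrite size_rcons addSnnS.
set b := pl _ _; have [||] := IHk (rcons t0 (a, true, b)) (k1 b).
- rewrite ltnS in dk; apply: leq_ltn_trans dk.
  by case: b; rewrite ?leq_maxl ?leq_maxr.
- by move=> t; rewrite cat_rcons ft0.
by rewrite step ffunE => -> ->; rewrite size_rcons addSnnS.
Qed.

Lemma run_tree :
  let e := eval (fun a => pl (v a)) (tr (r c)) [ffun=> [::]] in
  (@run alpha n O tree_protocol v r).1 = Some e.1 /\
  @cost alpha n O tree_protocol v r = e.2.
Proof.
have [||] := @run_from_tree (\max_x depth (tr x)).+1 [::] (tr (r c)) => //.
by rewrite ltnS; apply: (leq_bigmax_cond (F := fun x => depth (tr x))).
Qed.
End TreeProtocol.

(** * A two-round sketching protocol *)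

Section Sketch.
Local Open Scope nat_scope.
Variables (alpha n W cap : nat) (O : Type) (Seed Msg : finType) (s0 : Seed) (m0 : Msg).
Variables (f1 : Seed -> {set 'I_n} -> Msg) (agg : seq Msg -> Msg).
Variables (f2 : Seed -> Msg -> {set 'I_n} -> {set 'I_n}).
Variables (out : Msg -> {set 'I_n} -> O) (bad : O).

Definition csets (k : nat) : seq {set 'I_n} := enum [set A : {set 'I_n} | #|A| == k].

(* The dialogue with a server consists of five blocks: the seed (received), f1
   (sent), the aggregate M (received), the size of Z (sent), Z (sent).  The
   blanks nseq W false stand for the received blocks, so that the answer in a
   given position is the bit of the script in this position. *)
Definition sketch_player (S : {set 'I_n}) (view : bitseq) : bool :=
  let s := decode s0 (enum Seed) W (take W view) in
  let M := decode m0 (enum Msg) W (take W (drop (W + W) view)) in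
  let Z := f2 s M S in
  nth false ((nseq W false ++ encode (enum Msg) W (f1 s S) ++ nseq W false)
    ++ encode (iota 0 n.+1) W #|Z| ++ encode (csets #|Z|) (#|Z| * W) Z) (size view).

(** The announced size is checked before the set is requested, so a single reply brings at most
    [cap] items; this keeps the total within [2 * cap] even when the run aborts. *)
Fixpoint collect (M : Msg) (l : seq 'I_alpha) (D : {set 'I_n}) : tree alpha O :=
  if l is a :: l' then
    askW a W (fun w => let k := decode 0 (iota 0 n.+1) W w in
      if cap < k then Leaf alpha bad else
      askW a (k * W) (fun w' => let D' := D :|: decode set0 (csets k) (k * W) w' in
        if cap < #|D'| then Leaf alpha bad else collect M l' D'))
  else Leaf alpha (out M D).

Definition sketch_tree (s : Seed) : tree alpha O :=
  broadcast (encode (enum Seed) W s) (enum 'I_alpha)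
    (gather W (enum 'I_alpha) (fun ws =>
      let M := agg [seq decode m0 (enum Msg) W w | w <- ws] in
      broadcast (encode (enum Msg) W M) (enum 'I_alpha) (collect M (enum 'I_alpha) set0))).

Hypothesis cardSeed : #|Seed| <= 2 ^ W.
Hypothesis cardMsg : #|Msg| <= 2 ^ W.
Hypothesis ltn_n : n < 2 ^ W.

Variable v : {ffun 'I_alpha -> {set 'I_n}}.
Variable s : Seed.
Let g a := sketch_player (v a).

Lemma decode_seed : decode s0 (enum Seed) W (encode (enum Seed) W s) = s.
Proof. by rewrite encodeK ?mem_enum // -cardE. Qed.

Lemma decode_msg M : decode m0 (enum Msg) W (encode (enum Msg) W M) = M.
Proof. by rewrite encodeK ?mem_enum // -cardE. Qed.

Lemma decode_count (A : {set 'I_n}) :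
  decode 0 (iota 0 n.+1) W (encode (iota 0 n.+1) W #|A|) = #|A|.
Proof.
rewrite encodeK ?size_iota // mem_iota ltnS.
by rewrite (leq_trans (max_card _)) ?card_ord.
Qed.

Lemma ffact_leq_exp m k : m ^_ k <= m ^ k.
Proof.
elim: k m => [|k IHk] m; first by rewrite ffactn0.
rewrite ffactnS expnS leq_mul2l (leq_trans (IHk _)) ?orbT //.
by case: k {IHk} => // k; rewrite leq_exp2r ?leq_pred.
Qed.

(** There are at most [n ^ k <= 2 ^ (k * W)] sets of size [k], so [W] bits per item suffice. *)
Lemma decode_set (A : {set 'I_n}) :
  decode set0 (csets #|A|) (#|A| * W) (encode (csets #|A|) (#|A| * W) A) = A.
Proof.
rewrite encodeK ?mem_enum ?inE // -cardE card_draws card_ord.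
apply: leq_trans (leq_trans (ffact_leq_exp n #|A|) _).
  by rewrite -bin_ffact leq_pmulr ?fact_gt0.
rewrite mulnC expnM; case: #|A| => // k.
by rewrite leq_exp2r // ltnW.
Qed.

Lemma gather_answer a i : i < W ->
  g a (encode (enum Seed) W s ++ take i (encode (enum Msg) W (f1 s (v a))))
  = nth false (encode (enum Msg) W (f1 s (v a))) i.
Proof.
move=> iW; rewrite /g /sketch_player take_size_cat ?size_encode // decode_seed.
rewrite size_cat size_takel ?size_encode; last exact: ltnW.
by rewrite -!catA nth_cat size_nseq ltnNge leq_addr /= addKn nth_cat size_encode iW.
Qed.

Variable M : Msg.
Let base a := encode (enum Seed) W s ++ encode (enum Msg) W (f1 s (v a))
              ++ encode (enum Msg) W M.
Let Z a := f2 s M (v a).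

Lemma collect_answer a y :
  g a (base a ++ y) =
  nth false (encode (iota 0 n.+1) W #|Z a| ++ encode (csets #|Z a|) (#|Z a| * W) (Z a))
    (size y).
Proof.
have hs : take W (base a ++ y) = encode (enum Seed) W s.
  by rewrite /base -!catA take_size_cat ?size_encode.
have hM : take W (drop (W + W) (base a ++ y)) = encode (enum Msg) W M.
  rewrite /base -!catA -drop_drop !drop_size_cat ?size_encode //.
  by rewrite take_size_cat ?size_encode.
rewrite /g /sketch_player hs hM decode_seed decode_msg -/(Z a).
by rewrite nth_cat !size_cat !size_nseq !size_encode -!addnA ltnNge !addnA leq_addr /= addKn.
Qed.

(** The witness [D'] collects [D] and all sets received, including one that overflows [cap]; before
    that reply there are at most [cap] items, and the reply adds at most [cap]. Each received [Z a]
    lies in [D'], so its bits are charged to [Z a :&: D']; each announcement costs [W]. *)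
Lemma eval_collect l (D : {set 'I_n}) (vw : {ffun 'I_alpha -> bitseq}) : uniq l ->
  (forall a, a \in l -> vw a = base a) -> #|D| <= cap ->
  let e := eval g (collect M l D) vw in
  let U := D :|: \bigcup_(a <- l) Z a in
  (#|U| <= cap -> e.1 = out M U) /\
  exists D' : {set 'I_n}, [/\ D \subset D', D' \subset U, #|D'| <= 2 * cap &
    e.2 <= size l * W + (\sum_(a <- l) #|Z a :&: D'|) * W].
Proof.
elim: l D vw => [|a l IHl] D vw /= => [_ _ Dcap|/andP[al ul] vwb Dcap].
  rewrite !big_nil setU0; split=> //.
  by exists D; split=> //; rewrite mul2n -addnn (leq_trans Dcap) ?leq_addr.
set e1 := encode (iota 0 n.+1) W #|Z a|.
rewrite (eval_askW (w := e1)) ?size_encode // => [|i iW]; last first.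
  rewrite vwb ?mem_head // collect_answer nth_cat size_takel ?size_encode; last exact: ltnW.
  by rewrite -/e1 iW.
rewrite /= decode_count !big_cons setUA.
have [cap_lt|Zcap] := ltnP cap #|Z a|.
  split=> [|/=].
    rewrite leqNgt (leq_trans cap_lt) // subset_leq_card //.
    by rewrite setUAC subsetUr.
  exists D; rewrite subxx -setUA subsetUl; split=> //; last by rewrite mulSn -!addnA leq_addr.
  by rewrite mul2n -addnn (leq_trans Dcap) ?leq_addr.
set e2 := encode (csets #|Z a|) (#|Z a| * W) (Z a).
rewrite (eval_askW (w := e2)) ?size_encode // => [|i iW]; last first.
  rewrite ffunE eqxx vwb ?mem_head // -catA collect_answer size_cat.
  rewrite size_takel ?size_encode; last exact: ltnW.
  by rewrite nth_cat size_encode ltnNge leq_addr /= addKn.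
rewrite /= decode_set.
have [cap_lt|DZcap] := ltnP cap #|D :|: Z a|.
  split=> [|/=].
    by rewrite leqNgt (leq_trans cap_lt) // subset_leq_card // subsetUl.
  exists (D :|: Z a); split; rewrite ?subsetUl //.
    rewrite mul2n -addnn (leq_trans (leq_card_setU _ _)) ?leq_add //.
  by rewrite big_cons (setIidPl (subsetUr _ _)) mulSn mulnDl; lia.
have vwb' a' : a' \in l -> extend (extend vw a e1) a e2 a' = base a'.
  move=> a'l; have ne : a' != a by apply: contraNneq al => <-.
  by rewrite !ffunE (negPf ne) vwb // inE a'l orbT.
have [cor [D' [DD' D'U D'cap costD']]] := IHl _ _ ul vwb' DZcap.
split=> //; exists D'; split=> //.
  by apply: subset_trans DD'; apply: subsetUl.
have D'Z : Z a :&: D' = Z a.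
  by apply/setIidPl; apply: subset_trans DD'; apply: subsetUr.
rewrite big_cons D'Z mulSn mulnDl; move: costD'.
move: (eval _ _ _).2 (_ * W) (_ * W) (_ * W) => x y z t.
by lia.
Qed.
End Sketch.

Section SketchProtocol.
Local Open Scope nat_scope.
Variables (alpha n W cap : nat) (O : Type) (Seed Msg : finType) (s0 : Seed) (m0 : Msg).
Variables (f1 : Seed -> {set 'I_n} -> Msg) (agg : seq Msg -> Msg).
Variables (f2 : Seed -> Msg -> {set 'I_n} -> {set 'I_n}).
Variables (out : Msg -> {set 'I_n} -> O) (bad : O) (c : 'I_alpha).

Definition sketch_protocol : protocol alpha n O :=
  tree_protocol (T := Seed) c (sketch_tree alpha W cap m0 agg out bad) (sketch_player W s0 m0 f1 f2).

(** The term [4 * alpha] counts, per server, the seed, the message [f1], the aggregate and the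
    announced size, each of [W] bits. *)
Lemma run_sketch (v : {ffun 'I_alpha -> {set 'I_n}}) (r : {ffun 'I_alpha -> Seed}) :
  #|Seed| <= 2 ^ W -> #|Msg| <= 2 ^ W -> n < 2 ^ W ->
  let M := agg [seq f1 (r c) (v a) | a <- enum 'I_alpha] in
  let Z a := f2 (r c) M (v a) in
  (#|\bigcup_a Z a| <= cap ->
    (@run alpha n O sketch_protocol v r).1 = Some (out M (\bigcup_a Z a))) /\
  exists D : {set 'I_n}, [/\ D \subset \bigcup_a Z a, #|D| <= 2 * cap &
    @cost alpha n O sketch_protocol v r <= (4 * alpha + \sum_a #|Z a :&: D|) * W].
Proof.
move=> hS hM hn M Z.
have [-> ->] := run_tree (T := Seed) c (sketch_tree alpha W cap m0 agg out bad)
  (sketch_player W s0 m0 f1 f2) v r.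
rewrite /sketch_tree eval_broadcast (eval_gather (m := W)
  (F := fun a => encode (enum Msg) W (f1 (r c) (v a)))) /=; first last.
- by move=> a i iW; rewrite !ffunE; apply: gather_answer.
- by move=> a; rewrite size_encode.
rewrite eval_broadcast /= -map_comp (eq_map (g := fun a => f1 (r c) (v a))); last first.
  by move=> a; apply: decode_msg.
rewrite -/M; set vw := finfun _.
have vwE a : a \in enum 'I_alpha -> vw a = encode (enum Seed) W (r c)
    ++ encode (enum Msg) W (f1 (r c) (v a)) ++ encode (enum Msg) W M.
  by rewrite !ffunE /= catA.
have D0 : #|set0 : {set 'I_n}| <= cap by rewrite cards0.
have [cor [D [_ DU Dcap costD]]] :=
  eval_collect s0 m0 f2 out bad hS hM hn (enum_uniq _) vwE D0.
rewrite !set0U !big_enum /= in cor DU costD.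
split=> [/cor <-//|]; exists D; split=> //.
rewrite !size_encode; move: costD; rewrite size_enum_ord mulnDl -mulnA.
by move: (eval _ _ _).2 (_ * W) (_ * W) => x y z; lia.
Qed.
End SketchProtocol.

(** * Multiplicities and collisions *)

Section Collisions.
Variables (R : realType) (alpha n : nat) (v : {ffun 'I_alpha -> {set 'I_n}}).

Lemma sum_cardI (D : {set 'I_n}) :
  (\sum_a #|v a :&: D| = \sum_(x in D) #|[set a | x \in v a]|)%N.
Proof.
under eq_bigr => a _ do rewrite -sum1_card.
under [RHS]eq_bigr => x _ do rewrite -sum1_card.
rewrite (exchange_big_dep (mem D)) /= => [|a x _]; last by rewrite inE => /andP[].
apply: eq_bigr => x xD; apply: eq_bigl => a.
by rewrite !inE xD andbT.
Qed.

(** The square of [K] splits into the pairs below, above and on the diagonal, and [swap] exchanges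
    the first two kinds. *)
Lemma card_ltn_pairs (K : {set 'I_alpha}) :
  (#|K| * #|K| <= 2 * #|[set t : 'I_alpha * 'I_alpha |
      [&& (t.1 < t.2)%N, t.1 \in K & t.2 \in K]]| + #|K|)%N.
Proof.
set P := [set t | _].
pose swap (t : 'I_alpha * 'I_alpha) := (t.2, t.1).
have swapK : involutive swap by case.
rewrite -cardsX mul2n -addnn -{2}(card_preimset P (inv_inj swapK)).
rewrite -(card_imset K (f := fun a => (a, a))); last by move=> a b [].
apply: leq_trans (leq_trans (leq_card_setU _ _) (leq_add (leq_card_setU _ _) (leqnn _))).
apply/subset_leq_card/subsetP => -[a b]; rewrite !inE /= => /andP[aK bK].
rewrite aK bK !andbT; case: ltngtP => //= /val_inj ab.
by apply/imsetP; exists a; rewrite // ab.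
Qed.

Lemma collisions_sum :
  collisions v = (\sum_x #|[set t : 'I_alpha * 'I_alpha |
    [&& (t.1 < t.2)%N, t.1 \in [set a | x \in v a] & t.2 \in [set a | x \in v a]]]|)%N.
Proof.
under eq_bigr => x _ do rewrite -sum1_card.
rewrite /collisions -sum1_card (exchange_big_dep xpredT) //= pair_big_dep /=.
by apply: eq_bigl => -[[a b] x]; rewrite !inE.
Qed.

(* A server multiplicity k exceeding 3b accounts for at least b k collisions. *)
Lemma sum_cardI_le (b : R) (D : {set 'I_n}) : 1 <= b ->
  (\sum_a #|v a :&: D|)%:R <= 3 * b * #|D|%:R + (collisions v)%:R / b.
Proof.
move=> b1; have b0 : 0 < b by lra.
rewrite sum_cardI collisions_sum !natr_sum mulr_suml -sum1_card natr_sum mulr_sumr.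
apply: (@le_trans _ _ (\sum_(x in D) (3 * b * 1 + #|[set t : 'I_alpha * 'I_alpha |
    [&& (t.1 < t.2)%N, t.1 \in [set a | x \in v a] & t.2 \in [set a | x \in v a]]]|%:R / b))).
  apply: ler_sum => x _; have := card_ltn_pairs [set a | x \in v a].
  move: #|[set a | _]| #|[set t | _]| => p k; rewrite -(ler_nat R) natrM natrD natrM => kp.
  have p0 : 0 <= p%:R / b :> R by rewrite divr_ge0 // ltW.
  have [k3|k3] := lerP k%:R (3 * b).
    by rewrite mulr1 ler_wpDr.
  suff : k%:R <= p%:R / b :> R by move=> ?; rewrite ler_wpDl // !mulr_ge0 // ltW.
  (* As [k > 3 b] and [b >= 1], also [k - 1 >= 2 b], whence [p >= k (k - 1) / 2 >= b k]. *)
  have k0 : 0 <= k%:R :> R by [].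
  rewrite ler_pdivlMr //; have := mulr_ge0 k0 (ltW (etrans (subr_gt0 _ _) k3)).
  have := mulr_ge0 k0 (etrans (subr_ge0 _ _) b1); lra.
rewrite big_split /= lerD2l [leRHS](bigID (mem D)) /= lerDl sumr_ge0 // => x _.
by rewrite divr_ge0 // ltW.
Qed.
End Collisions.

(** * Pairwise independent hashing *)

Section Pairwise.
Variables (R : realType) (T : finType) (n q : nat) (h : T -> 'I_n -> 'I_q).

(** Uniformity and pairwise independence with denominators cleared, tested on one target set [J] as
    in the moments of [hits]. *)
Definition pairwise_uniform : Prop :=
  (forall x (J : {set 'I_q}), #|[set s | h s x \in J]| * q = #|J| * #|T|)%N /\
  (forall x y (J : {set 'I_q}), x != y ->
    #|[set s | (h s x \in J) && (h s y \in J)]| * (q * q) = #|J| * #|J| * #|T|)%N.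

Hypothesis pw : pairwise_uniform.
Hypothesis q0 : (0 < q)%N.
Variables (U : {set 'I_n}) (J : {set 'I_q}).

Definition hits (s : T) : {set 'I_n} := [set x in U | h s x \in J].
Definition mean : R := #|U|%:R * #|J|%:R / q%:R.

Let p : R := #|J|%:R / q%:R.
Let e (s : T) (x : 'I_n) : R := (h s x \in J)%:R - p.

Lemma sum_indicator (P : pred T) : \sum_s (P s)%:R = #|[set s | P s]|%:R :> R.
Proof.
rewrite -sum1_card natr_sum [RHS]big_mkcond /=.
by apply: eq_bigr => s _; rewrite inE; case: (P s).
Qed.

Lemma sum_hit x : \sum_s (h s x \in J)%:R = p * #|T|%:R :> R.
Proof.
have qR : q%:R != 0 :> R by rewrite pnatr_eq0 -lt0n.
rewrite sum_indicator /p mulrAC -natrM -(proj1 pw x J) natrM mulfK //.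
Qed.

Lemma sum_hit2 x y : x != y ->
  \sum_s (h s x \in J)%:R * (h s y \in J)%:R = p * p * #|T|%:R :> R.
Proof.
have qR : q%:R != 0 :> R by rewrite pnatr_eq0 -lt0n.
move=> xy; under eq_bigr => s _ do rewrite -natrM mulnb.
rewrite sum_indicator; apply: (mulIf (mulf_neq0 qR qR)).
by rewrite -!natrM (proj2 pw x y J xy) !natrM /p; field.
Qed.

Lemma centered_sum s : #|hits s|%:R - mean = \sum_(x in U) e s x.
Proof.
rewrite big_split /= sumr_const /mean -mulrA -/p; congr (_ + _).
  rewrite -sum1_card natr_sum [RHS]big_mkcond [LHS]big_mkcond /=.
  by apply: eq_bigr => x _; rewrite inE; case: (x \in U) => //=; case: (_ \in J).
by rewrite mulNrn mulr_natl.
Qed.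

(** Pairwise independence cancels the cross terms, and each diagonal term averages to
    [p - p * p <= p]. Sums over seeds are not normalised, hence the factor [#|T|]. *)
Lemma variance : \sum_s (#|hits s|%:R - mean) ^+ 2 <= mean * #|T|%:R.
Proof.
have p1 : p <= 1.
  by rewrite ler_pdivrMr ?ltr0n // mul1r ler_nat (leq_trans (max_card _)) ?card_ord.
have p0 : 0 <= p by rewrite divr_ge0.
under eq_bigr => s _ do rewrite centered_sum expr2 big_distrlr /=.
rewrite exchange_big /=; under eq_bigr => x xU do rewrite exchange_big /=.
have -> : mean * #|T|%:R = \sum_(x in U) p * #|T|%:R.
  by rewrite sumr_const /mean -[RHS]mulr_natl -!mulrA.
apply: ler_sum => x xU; rewrite (bigD1 x) //= [X in _ + X]big1 => [|y /andP[yU yx]].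
  rewrite addr0; apply: (@le_trans _ _
    (\sum_s ((h s x \in J)%:R * (1 - 2 * p) + p * p))).
    by apply: ler_sum => s _; rewrite /e; case: (_ \in J) => /=; lra.
  rewrite big_split /= -mulr_suml sum_hit sumr_const -[_ * _ *+ _]mulr_natl.
  have : 0 <= #|T|%:R :> R by []. 
  move: #|T|%:R => t t0; suff : 0 <= t * p * p by lra.
  by rewrite mulr_ge0 // mulr_ge0.
rewrite (eq_bigr (fun s => (h s y \in J)%:R * (h s x \in J)%:R
    + (- p * (h s y \in J)%:R + (- p * (h s x \in J)%:R + p * p)))) => [|s _]; last first.
  by rewrite /e; ring.
rewrite !big_split /= sumr_const -!mulr_sumr sum_hit2 // !sum_hit -[_ * _ *+ _]mulr_natl.
by ring.
Qed.

Lemma chebyshev (t : R) : 0 <= t ->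
  #|[set s | t <= `|#|hits s|%:R - mean|]|%:R * t ^+ 2 <= mean * #|T|%:R.
Proof.
move=> t0; apply: le_trans variance.
rewrite -sum_indicator mulr_suml; apply: ler_sum => s _.
case: (lerP t) => /= [ts|_]; last by rewrite mul0r sqr_ge0.
by rewrite mul1r -[leRHS]real_normK ?num_real // lerXn2r ?nnegrE.
Qed.

(** Centred sums cancel over all seeds, so [mean * #|T|] is the total number of hits, to which a
    nonempty set contributes at least 1. *)
Lemma markov : #|[set s | hits s != set0]|%:R <= mean * #|T|%:R.
Proof.
rewrite -sum_indicator.
have -> : mean * #|T|%:R = \sum_s #|hits s|%:R.
  under [RHS]eq_bigr => s _ do rewrite -(subrK mean #|hits s|%:R) centered_sum.
  rewrite big_split sumr_const -[mean *+ _]mulr_natr /= exchange_big big1 ?add0r //= => x _.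
  by rewrite big_split /= sum_hit sumr_const mulNrn -[p *+ _]mulr_natr subrr.
by apply: ler_sum => s _; rewrite -card_gt0 ler_nat; case: #|_|.
Qed.
End Pairwise.

(** * Affine hash functions over a finite field *)

Section AffineHash.
Variables (F : finFieldType) (n : nat) (iota : 'I_n -> F).
Hypothesis iota_inj : injective iota.

Definition affine_hash (s : F * F) (x : 'I_n) : 'I_#|F| := enum_rank (s.1 * iota x + s.2).

(** For [x != y] the map from a seed to its two hash values is a linear system with determinant
    [iota x - iota y], which is nonzero; hence it is injective on [F * F] and preimages keep their
    size. *)
Lemma affine_hash_pairwise : pairwise_uniform affine_hash.
Proof.
have cardK (J : {set 'I_#|F|}) : #|[set y : F | enum_rank y \in J]| = #|J|.
  by rewrite -[RHS](on_card_preimset (f := @enum_rank F)) //; apply: onW_bij (enum_rank_bij F).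
split=> [x J|x y J xy].
  pose f (s : F * F) := (s.1, s.1 * iota x + s.2).
  have f_inj : injective f by move=> [a b] [a' b'] [-> /addrI->].
  rewrite (_ : [set s | _] = f @^-1: setX [set: F] [set y | enum_rank y \in J]); last first.
    by apply/setP => s; rewrite !inE.
  by rewrite card_preimset // cardsX cardsT cardK card_prod mulnAC [RHS]mulnC.
pose f (s : F * F) := (s.1 * iota x + s.2, s.1 * iota y + s.2).
have f_inj : injective f.
  move=> [a b] [a' b'] [/= ex ey].
  have : (a - a') * (iota x - iota y) = 0.
    have -> : (a - a') * (iota x - iota y)
      = (a * iota x + b) - (a' * iota x + b') - (a * iota y + b) + (a' * iota y + b') by ring.
    by rewrite ex ey; ring.
  move/eqP; rewrite mulf_eq0 !subr_eq0 (inj_eq iota_inj) (negPf xy) orbF => /eqP aa.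
  by move: ex; rewrite aa => /addrI->.
rewrite (_ : [set s | _] = f @^-1: setX [set y | enum_rank y \in J] [set y | enum_rank y \in J]).
  by rewrite card_preimset // cardsX !cardK card_prod.
by apply/setP => s; rewrite !inE.
Qed.
End AffineHash.

(** * Sets of small hash values *)

Section Lowset.
Variables (R : realType) (q : nat).

(** Hash values are counted from 1, so that for [z >= 0] the size is the integer part of [z], cut
    off at [q]. *)
Definition lowset (z : R) : {set 'I_q} := [set i : 'I_q | i.+1%:R <= z].

Lemma card_lowset z : #|lowset z| = minn q (Num.truncn z).
Proof.
have -> : lowset z = [set i : 'I_q | (i < Num.truncn z)%N].
  by apply/setP => i; rewrite !inE truncn_gt_nat.
have [le_q|lt_q] := leqP q (Num.truncn z).
  rewrite -[RHS]card_ord -cardsT; apply: eq_card => i.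
  by rewrite !inE (leq_trans (ltn_ord i) le_q).
rewrite -[RHS]card_ord -cardsT.
rewrite -(card_imset _ (f := widen_ord (ltnW lt_q))); last by move=> i j [] /val_inj.
apply: eq_card => i; rewrite !inE; apply/idP/imsetP => [iz|[j _ ->] //=].
by exists (Ordinal iz) => //; apply: val_inj.
Qed.

Lemma lowset_le z : 0 <= z -> #|lowset z|%:R <= z.
Proof.
move=> z0; rewrite card_lowset.
have /andP[trunc_z _] := truncn_itv z0.
by apply: le_trans trunc_z; rewrite ler_nat geq_minr.
Qed.

Lemma lowset_ge z : lowset z = setT \/ z - 1 <= #|lowset z|%:R.
Proof.
have [le_q|lt_q] := leqP q (Num.truncn z); [left|right].
  by apply/eqP; rewrite eqEcard subsetT cardsT card_ord card_lowset (minn_idPl le_q) /=.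
rewrite card_lowset (minn_idPr (ltnW lt_q)) lerBlDr natr1 ltW //.
exact: truncnS_gt.
Qed.
End Lowset.

(** * The estimator *)

Section Estimator.
Variables (R : realType) (T : finType) (n q : nat) (h : T -> 'I_n -> 'I_q).
Hypotheses (pw : pairwise_uniform h) (nq : (n <= q)%N).
Variable U : {set 'I_n}.
Hypothesis U0 : U != set0.

Let N : R := #|U|%:R.
Let Q : R := q%:R.

Lemma cardU_gt0 : 0 < N. Proof. by rewrite ltr0n card_gt0. Qed.

Lemma cardU_le : N <= Q.
Proof. by rewrite ler_nat (leq_trans _ nq) // (leq_trans (max_card _)) ?card_ord. Qed.

Lemma q_gt0 : 0 < Q.
Proof. exact: lt_le_trans cardU_gt0 cardU_le. Qed.

Definition scale (m : nat) : bool := (Q / (10 * N) < m.+1%:R) && (m.+1%:R <= 10 * Q / N).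

(** The premise says that [M s] is the least hash value on [U]. Too small a minimum means a hit in
    [J1], of mean at most 1/10; too large a one means no hit in [J2], of mean at least 9 unless
    everything hits. Markov and Chebyshev give 1/10 + 1/9 = 19/90. *)
Lemma scale_prob (M : T -> nat) :
  (forall s t, (t <= M s)%N <-> (t <= q)%N /\ forall x, x \in U -> (t <= h s x)%N) ->
  #|[set s | ~~ scale (M s)]|%:R <= 19 / 90 * #|T|%:R :> R.
Proof.
move=> ME; have N0 := cardU_gt0; have NQ := cardU_le; have Q0 := q_gt0.
have q0 : (0 < q)%N by rewrite -(ltr0n R).
pose J1 := lowset q (Q / (10 * N)); pose J2 := lowset q (10 * Q / N).
set B1 := [set s | hits h U J1 s != set0].
set B2 := [set s | hits h U J2 s == set0].
have sub : [set s | ~~ scale (M s)] \subset B1 :|: B2.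
  apply/subsetP => s; rewrite !inE negb_and -leNgt -ltNge => /orP[lo|hi]; apply/orP.
    left; have [Mq hM] := proj1 (ME s (M s)) (leqnn _).
    (* If nothing hits [J1], every hash value on [U] exceeds [M s], so that [(M s).+1] would be a
       lower bound too. *)
    have : ~ ((M s).+1 <= M s)%N by rewrite ltnn.
    apply: contra_notT => /negPn/eqP hits0; apply/ME; split.
      have /set0Pn[x xU] := U0; exact: leq_ltn_trans (hM x xU) (ltn_ord _).
    move=> x xU; rewrite ltn_neqAle hM // andbT; apply: contraTneq lo => Mx.
    have : x \notin hits h U J1 s by rewrite hits0 inE.
    by rewrite !inE xU /= Mx.
  right; apply/eqP/setP => x; rewrite !inE; apply/negP => /andP[xU].
  apply/negP; rewrite -ltNge (lt_le_trans hi) // ler_nat ltnS.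
  by have [_ ->] := proj1 (ME s (M s)) (leqnn _).
have T0 : 0 <= #|T|%:R :> R by [].
have b1 : #|B1|%:R <= 1 / 10 * #|T|%:R :> R.
  apply: le_trans (markov R pw q0 U J1) _; apply: ler_wpM2r => //.
  rewrite /mean -/N -/Q.
  have le1 : #|J1|%:R <= Q / (10 * N).
    by apply: lowset_le; rewrite divr_ge0 ?mulr_ge0 ?ler0n.
  rewrite ler_pdivrMr //; apply: le_trans (ler_wpM2l (ltW N0) le1) _.
  by rewrite le_eqVlt; apply/orP; left; apply/eqP; field; rewrite ?gt_eqF.
have b2 : #|B2|%:R <= 1 / 9 * #|T|%:R :> R.
  have [full|ge2] := @lowset_ge R q (10 * Q / N).
    suff -> : B2 = set0 by rewrite cards0; lra.
    apply/setP => s; rewrite !inE; apply/negbTE; have /set0Pn[x xU] := U0; apply/set0Pn; exists x.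
    by rewrite inE xU /J2 full inE.
  (* Rounding loses at most one element of [J2], that is, [N / Q <= 1] of the mean 10. *)
  have mean9 : 9 <= mean R U J2.
    rewrite /mean -/N -/Q ler_pdivlMr //; rewrite -(ler_pM2l N0) in ge2.
    apply: le_trans ge2; rewrite mulrBr mulr1 mulrCA divff ?gt_eqF // mulr1; lra.
  have mu0 : 0 < mean R U J2 by lra.
  have := chebyshev pw q0 U J2 (ltW mu0).
  rewrite expr2 mulrA mulrAC [leRHS]mulrC ler_pM2r // => le_x.
  have le_b : #|B2|%:R <= #|[set s | mean R U J2 <= `|#|hits h U J2 s|%:R - mean R U J2|]|%:R :> R.
    rewrite ler_nat subset_leq_card //; apply/subsetP => s; rewrite !inE => /eqP->.
    by rewrite cards0 sub0r normrN ler_norm.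
  rewrite mul1r ler_pdivlMl //; apply: le_trans le_x; rewrite mulrC.
  by apply: ler_pM.
apply: (@le_trans _ _ (#|B1|%:R + #|B2|%:R)); last by lra.
by rewrite -natrD ler_nat (leq_trans (subset_leq_card sub)) ?leq_card_setU.
Qed.

Variables (eps : R) (m : nat).
Hypotheses (eps0 : 0 < eps) (eps1 : eps < 1) (scale_m : scale m).

Let J := lowset q (91 * m.+1%:R / eps ^+ 2).

Lemma inv_eps2_ge1 : 1 <= (eps ^+ 2)^-1.
Proof. by rewrite invf_ge1 ?exprn_gt0 // expr_le1 // ltW. Qed.

Lemma scale_mul : Q <= 10 * (N * m.+1%:R) /\ N * m.+1%:R <= 10 * Q.
Proof.
have N0 := cardU_gt0; have /andP[lo hi] := scale_m; split.
  by move: lo; rewrite ltr_pdivrMr ?mulr_gt0 // => /ltW; rewrite mulrCA [_ * N]mulrC.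
by move: hi; rewrite ler_pdivlMr // mulrC.
Qed.

(** The constant is 91 = 9 * 10 + 1: as [Q <= 10 N (m + 1)], the share 90 yields the mean
    [9 / eps ^+ 2], and the remaining 1 absorbs the rounding of [#|J|]. *)
Lemma mean_ge : J = setT \/ 9 / eps ^+ 2 <= mean R U J.
Proof.
have [full|ge_J] := @lowset_ge R q (91 * m.+1%:R / eps ^+ 2); [by left|right].
have N0 := cardU_gt0; have Q0 := q_gt0; have [lo _] := scale_mul.
rewrite /mean -/N -/Q ler_pdivlMr //.
apply: le_trans (ler_wpM2l (ltW N0) ge_J).
have u1 := inv_eps2_ge1; move: (eps ^+ 2)^-1 u1 => u u1.
have M1 : 1 <= m.+1%:R :> R by rewrite ler1n.
have NM : N <= N * m.+1%:R by rewrite ler_peMr // ltW.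
have NM0 := lt_le_trans N0 NM.
have NMu : N * m.+1%:R <= N * m.+1%:R * u by rewrite ler_peMr // ltW.
have Qu : Q * u <= 10 * (N * m.+1%:R) * u by rewrite ler_wpM2r // (le_trans ler01).
lra.
Qed.

(** Here 1820 = 2 * 91 * 10, the last factor coming from [N (m + 1) <= 10 Q]. *)
Lemma mean_le : 2 * mean R U J <= 1820 / eps ^+ 2.
Proof.
have N0 := cardU_gt0; have Q0 := q_gt0; have [_ hi] := scale_mul.
have u1 := inv_eps2_ge1.
have u0 : 0 <= (eps ^+ 2)^-1 by lra.
have le_J : #|J|%:R <= 91 * m.+1%:R / eps ^+ 2 by apply: lowset_le; rewrite !mulr_ge0.
rewrite mulrC -ler_pdivlMr // /mean -/N -/Q ler_pdivrMr //.
apply: le_trans (ler_wpM2l (ltW N0) le_J) _.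
have := ler_wpM2r u0 hi; lra.
Qed.

Lemma lowset_gt0 : 0 < #|J|%:R :> R.
Proof.
have Q0 := q_gt0; have [->|mean9] := mean_ge; first by rewrite cardsT card_ord.
rewrite lt_neqAle ler0n andbT; apply/eqP => J0; move: mean9.
rewrite /mean -J0 mulr0 mul0r leNgt mulr_gt0 // invr_gt0 exprn_gt0 //.
Qed.

(** Chebyshev at distance [eps * mean] bounds the failure by [1 / (eps ^+ 2 * mean) <= 1 / 9]; if
    [J] is everything, the count is exact. *)
Lemma estimate_prob :
  #|[set s | ~~ (`|#|hits h U J s|%:R - mean R U J| <= eps * mean R U J)]|%:R
    <= 1 / 9 * #|T|%:R :> R.
Proof.
have N0 := cardU_gt0; have Q0 := q_gt0.
have q0 : (0 < q)%N by rewrite -(ltr0n R).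
have mu_gt0 : 0 < mean R U J by rewrite /mean !mulr_gt0 ?invr_gt0 ?lowset_gt0.
have [full|mean9] := mean_ge.
  suff -> : [set s | ~~ (`|#|hits h U J s|%:R - mean R U J| <= eps * mean R U J)] = set0.
    by rewrite cards0 mulr_ge0 ?divr_ge0.
  apply/setP => s; rewrite !inE; apply/negbTE; rewrite negbK.
  have -> : hits h U J s = U by apply/setP => x; rewrite inE full inE andbT.
  have {1}-> : mean R U J = N by rewrite /mean full cardsT card_ord mulfK ?gt_eqF.
  by rewrite subrr normr0 mulr_ge0 ?ltW.
have t0 : 0 < eps * mean R U J by rewrite mulr_gt0.
have := chebyshev pw q0 U J (ltW t0).
have sq_mul (x mu : R) : x * (eps * mu) ^+ 2 = x * (eps ^+ 2 * mu) * mu by ring.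
rewrite sq_mul [leRHS]mulrC ler_pM2r // => le_x.
rewrite mul1r ler_pdivlMl //; apply: le_trans le_x; rewrite mulrC.
apply: ler_pM => //.
  rewrite ler_nat subset_leq_card //; apply/subsetP => s; rewrite !inE -ltNge.
  exact: ltW.
by move: mean9; rewrite ler_pdivrMr ?exprn_gt0 // mulrC.
Qed.

(** As [eps < 1], the count is at most twice the mean, hence within the cap; multiplying by
    [Q / #|J|] turns the mean into [N] and preserves the relative error. *)
Lemma estimate_good s : `|#|hits h U J s|%:R - mean R U J| <= eps * mean R U J ->
  (#|hits h U J s| <= Num.truncn (1820 / eps ^+ 2 : R))%N /\
  approx eps N (#|hits h U J s|%:R * Q / #|J|%:R).
Proof.
have J0 := lowset_gt0; have Q0 := q_gt0; have N0 := cardU_gt0.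
have mu_gt0 : 0 < mean R U J by rewrite /mean !mulr_gt0 ?invr_gt0.
rewrite ler_distl => /andP[lo hi]; split.
  rewrite truncn_ge_nat; last by rewrite mulr_ge0 // invr_ge0 exprn_ge0 // ltW.
  apply: le_trans mean_le; apply: le_trans hi _.
  by rewrite mulr_natl mulr2n lerD2l ler_piMl // ltW.
have NE : N = mean R U J * (Q / #|J|%:R).
  by rewrite /mean -/N -/Q; field; rewrite !gt_eqF.
have QJ0 : 0 < Q / #|J|%:R by rewrite divr_gt0.
have := ler_wpM2r (ltW QJ0) lo; have := ler_wpM2r (ltW QJ0) hi.
rewrite /approx NE -mulrA; move: (mean R U J) (Q / _) (#|hits h U J s|%:R : R).
by move=> mu w x hiw low; apply/andP; split; lra.
Qed.
End Estimator.

(** * Events that depend on the coordinator's seed *)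

Lemma card_marginal (I T : finType) (c : I) (G : pred T) :
  (#|[set r : {ffun I -> T} | G (r c)]| * #|T| = #|{ffun I -> T}| * #|[set x | G x]|)%N.
Proof.
(* Exchanging r c with an independent x is an involution. *)
pose swap (p : {ffun I -> T} * T) := ([ffun a => if a == c then p.2 else p.1 a], p.1 c).
have swapK : involutive swap.
  move=> [r x]; rewrite /swap /=; congr (_, _); last by rewrite ffunE eqxx.
  by apply/ffunP => a; rewrite !ffunE; case: eqP => // ->.
rewrite -cardsT -cardsX -[#|{ffun _}|]cardsT -cardsX -(card_preimset _ (inv_inj swapK)).
by apply: eq_card => -[r x]; rewrite !inE /= ffunE eqxx andbT.
Qed.

Section Probability.
Variables (R : realType) (alpha n : nat) (O : Type) (P : protocol alpha n O).

(** The coordinator's seed is uniform under the joint distribution, so failures may be counted on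
    that seed alone. *)
Lemma prob_ge (G : pred (Rnd P)) (E : pred {ffun 'I_alpha -> Rnd P}) :
  (0 < #|Rnd P|)%N -> #|[set s | ~~ G s]|%:R <= 1 / 3 * #|Rnd P|%:R :> R ->
  (forall r : {ffun 'I_alpha -> Rnd P}, G (r (coord_id P)) -> E r) -> 2 / 3 <= prob R E.
Proof.
move=> T0 bad GE; have ffun0 : (0 < #|{ffun 'I_alpha -> Rnd P}|)%N.
  by rewrite card_ffun expn_gt0 T0.
rewrite /prob ler_pdivlMr ?ltr0n //.
apply: (@le_trans _ _ #|[set r : {ffun 'I_alpha -> Rnd P} | G (r (coord_id P))]|%:R); last first.
  by rewrite ler_nat subset_leq_card //; apply/subsetP => r; rewrite !inE; apply: GE.
have T0R : 0 < #|Rnd P|%:R :> R by rewrite ltr0n.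
rewrite -(ler_pM2r T0R) -natrM card_marginal natrM mulrAC mulrC ler_pM2l ?ltr0n //.
have cE : ~: [set x | G x] = [set s | ~~ G s] by apply/setP => s; rewrite !inE.
have := congr1 (fun k => k%:R : R) (cardsC [set x | G x]).
rewrite /= cE natrD => card_sum.
by move: bad; rewrite -card_sum; lra.
Qed.
End Probability.

(** A union bound in which the second event is rare conditionally on each good first seed. *)
Lemma card_pair_le (R : realType) (T1 T2 : finType) (B1 : pred T1) (B2 : T1 -> pred T2)
  (d1 d2 : R) : 0 <= d2 -> #|[set s | B1 s]|%:R <= d1 * #|T1|%:R ->
  (forall s, ~~ B1 s -> #|[set t | B2 s t]|%:R <= d2 * #|T2|%:R) ->
  #|[set p : T1 * T2 | B1 p.1 || B2 p.1 p.2]|%:R <= (d1 + d2) * #|{: T1 * T2}|%:R.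
Proof.
move=> d2_ge0 le1 le2; rewrite -sum_indicator.
rewrite -(pair_big xpredT xpredT (fun s t => (B1 s || B2 s t)%:R)) /=.
apply: (@le_trans _ _ (\sum_s ((B1 s)%:R * #|T2|%:R + d2 * #|T2|%:R))).
  apply: ler_sum => s _; have [B1s|nB1s] := boolP (B1 s) => /=.
    rewrite sumr_const mul1r lerDl mulr_ge0 //.
  by rewrite mul0r add0r sum_indicator; apply: le2.
rewrite big_split /= -mulr_suml sum_indicator sumr_const -[_ * _ *+ _]mulr_natl card_prod natrM.
have := ler_wpM2r (ler0n R #|T2|) le1; lra.
Qed.

(** * Minimum hash values *)

Section MinHash.
Local Open Scope nat_scope.
Variables (T : finType) (n q : nat) (h : T -> 'I_n -> 'I_q).

(** An empty set reports [q], which exceeds every hash value; hence the type ['I_q.+1]. *)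
Definition min_hash (s : T) (S : {set 'I_n}) : 'I_q.+1 :=
  inord (foldr minn q [seq val (h s x) | x <- enum S]).

Definition min_all (l : seq 'I_q.+1) : 'I_q.+1 :=
  inord (foldr minn q [seq val i | i <- l]).

Lemma leq_foldr_minn t l : (t <= foldr minn q l) = (t <= q) && all (leq t) l.
Proof. by elim: l => [|x l IHl] /=; rewrite ?andbT // leq_min IHl andbCA. Qed.

Lemma leq_inord_foldr_minn t l :
  (t <= (inord (foldr minn q l) : 'I_q.+1)) = (t <= q) && all (leq t) l.
Proof.
rewrite inordK ?leq_foldr_minn // ltnS.
by have := leq_foldr_minn (foldr minn q l) l; rewrite leqnn => /esym/andP[].
Qed.

(** Lower bounds characterise a minimum and combine over servers without treating empty sets apart;
    [scale_prob] expects this form. *)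
Lemma leq_min_all (alpha : nat) (v : {ffun 'I_alpha -> {set 'I_n}}) s t :
  t <= min_all [seq min_hash s (v a) | a <- enum 'I_alpha] <->
  t <= q /\ forall x, x \in \bigcup_a v a -> t <= h s x.
Proof.
rewrite leq_inord_foldr_minn; split=> [/andP[tq /allP tM]|[tq tU]].
  split=> // x /bigcupP[a _ xa].
  have : t <= min_hash s (v a).
    by apply: tM; rewrite map_f //; apply: map_f; rewrite mem_enum.
  rewrite leq_inord_foldr_minn tq => /allP; apply.
  by apply: map_f; rewrite mem_enum.
rewrite tq; apply/allP => _ /mapP[_ /mapP[a _ ->] ->] /=.
rewrite leq_inord_foldr_minn tq; apply/allP => _ /mapP[x xa ->].
by apply: tU; apply/bigcupP; exists a => //; rewrite mem_enum in xa.
Qed.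
End MinHash.

(** * The protocol for F0: correctness and cost *)

Section F0Protocol.
Variables (R : realType) (T : finType) (alpha n q W : nat) (h : T -> 'I_n -> 'I_q).
Variables (s0 : T) (c : 'I_alpha) (eps : R).
Hypotheses (pw : pairwise_uniform h) (nq : (n <= q)%N).
Hypotheses (cardT : (#|{: T * T}| <= 2 ^ W)%N) (qW : (q.+1 <= 2 ^ W)%N) (nW : (n < 2 ^ W)%N).
Hypotheses (eps0 : 0 < eps) (eps1 : eps < 1).

Let J (M : 'I_q.+1) : {set 'I_q} := lowset q (91 * M.+1%:R / eps ^+ 2).
Let cap : nat := Num.truncn (1820 / eps ^+ 2).
Let est (M : 'I_q.+1) (D : {set 'I_n}) : R := #|D|%:R * q%:R / #|J M|%:R.

(** Independent seeds fix the sampling set [J M] and draw the sample, so that Chebyshev applies to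
    the sample for each fixed [M]. *)
Definition f0_protocol : protocol alpha n R :=
  @sketch_protocol alpha n W cap R (T * T)%type 'I_q.+1 (s0, s0) ord0
    (fun s => min_hash h s.1) (@min_all q) (fun s M S => hits h S (J M) s.2) est 0 c.

Variable v : {ffun 'I_alpha -> {set 'I_n}}.
Let U := \bigcup_a v a.
Let M (s : T * T) := min_all [seq min_hash h s.1 (v a) | a <- enum 'I_alpha].

(** All servers use one hash function, so sampling commutes with union. *)
Lemma bigcup_hits s K : \bigcup_a hits h (v a) K s = hits h U K s.
Proof.
apply/setP => x; rewrite inE; apply/bigcupP/andP => [[a _]|[/bigcupP[a _ xa] xK]].
  by rewrite inE => /andP[xa ->]; split=> //; apply/bigcupP; exists a.
by exists a; rewrite // inE xa.
Qed.

Let run_f0 (r : {ffun 'I_alpha -> T * T}) :=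
  @run_sketch alpha n W cap R (T * T)%type 'I_q.+1 (s0, s0) ord0
    (fun s => min_hash h s.1) (@min_all q) (fun s M S => hits h S (J M) s.2) est 0 c v r.

Lemma f0_prob :
  2 / 3 <= @prob R alpha n R f0_protocol
    (fun r => approx_out eps (F0 v)%:R (@run alpha n R f0_protocol v r).1).
Proof.
have cardM : (#|'I_q.+1| <= 2 ^ W)%N by rewrite card_ord.
(* Good seeds: with an empty union the estimate 0 is exact; otherwise the minimum has the right
   scale and the sample size is close to its mean. *)
pose G (s : T * T) := (U == set0) ||
  (scale R q U (M s) && (`|#|hits h U (J (M s)) s.2|%:R - mean R U (J (M s))|
     <= eps * mean R U (J (M s)))).
apply: (@prob_ge R alpha n R f0_protocol G).
- by apply/card_gt0P; exists (s0, s0).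
- have [U0|U0] := boolP (U == set0).
    suff -> : [set s | ~~ G s] = set0 by rewrite cards0 mulr_ge0 ?divr_ge0.
    by apply/setP => s; rewrite !inE /G U0.
  have le1 := scale_prob R pw nq U0 (fun s t => leq_min_all h v s t).
  (* [M] depends on the first seed only; [s0] fills the second place. *)
  have := @card_pair_le R T T (fun s => ~~ scale R q U (M (s, s0)))
    (fun s1 s => ~~ (`|#|hits h U (J (M (s1, s0))) s|%:R - mean R U (J (M (s1, s0)))|
     <= eps * mean R U (J (M (s1, s0))))) (19 / 90) (1 / 9) _ le1.
  move=> le_bad; apply: (@le_trans _ _ ((19 / 90 + 1 / 9) * #|{: T * T}|%:R)); last first.
    by apply: ler_wpM2r => //; lra.
  apply: le_trans (le_bad _ _); rewrite ?divr_ge0 //.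
    rewrite ler_nat subset_leq_card //; apply/subsetP => -[s1 s2].
    by rewrite !inE /G (negPf U0) /= negb_and.
  by move=> s; rewrite negbK => sc; apply: estimate_prob.
move=> r; have [cor _] := run_f0 r cardT cardM nW; rewrite /G.
have [/eqP U0 _|U0 /= /andP[sc good]] := boolP (U == set0).
  have hits0 s K : hits h U K s = set0 by apply/setP => x; rewrite U0 !inE.
  rewrite cor bigcup_hits hits0 ?cards0 //.
  by rewrite /= /F0 -/U U0 /est /approx cards0 !mul0r !mulr0 lexx.
have [hcap happrox] := estimate_good nq U0 eps0 eps1 sc good.
by rewrite cor bigcup_hits.
Qed.

(** Here [b] stands for the square root of beta. The set [D] has at most [F0 v] and at most
    [2 * 1820 / eps ^+ 2] items, whence 3640; the charge [3 b #|D|] gives the factor 3, and dividing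
    the collisions by [b] leaves at most [b c0 m]. *)
Lemma f0_cost (b c0 : R) r : 1 <= b -> 0 < c0 ->
  let m := Num.min ((F0 v)%:R) (1 / eps ^+ 2) in
  (collisions v)%:R <= b ^+ 2 * (c0 * m) ->
  (@cost alpha n R f0_protocol v r)%:R <= (4 * alpha%:R + m * b * (3 * 3640 + c0)) * W%:R.
Proof.
move=> b1 c0_gt0 m Cle; have cardM : (#|'I_q.+1| <= 2 ^ W)%N by rewrite card_ord.
have [_ [D [DU Dcap Dcost]]] := run_f0 r cardT cardM nW.
rewrite bigcup_hits in DU.
have b0 : 0 < b by lra.
have m0 : 0 <= m by rewrite le_min ler0n divr_ge0 // exprn_ge0 // ltW.
have Dm : #|D|%:R <= 3640 * m.
  rewrite minr_pMr // le_min; apply/andP; split.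
    apply: (@le_trans _ _ (F0 v)%:R); last by rewrite ler_peMl // ler1n.
    rewrite ler_nat subset_leq_card // (subset_trans DU) //.
    by apply/subsetP => x; rewrite inE => /andP[].
  apply: (@le_trans _ _ (2 * cap)%:R); first by rewrite ler_nat.
  have cap_le : cap%:R <= 1820 / eps ^+ 2.
    by rewrite truncn_le divr_ge0 // exprn_ge0 // ltW.
  by rewrite natrM; lra.
have sum_le := sum_cardI_le v D b1.
apply: le_trans (_ : ((4 * alpha + \sum_a #|v a :&: D|) * W)%:R <= _).
  rewrite ler_nat (leq_trans Dcost) // leq_mul2r leq_add2l leq_sum ?orbT // => a _.
  by rewrite subset_leq_card // setSI //; apply/subsetP => x; rewrite inE => /andP[].
rewrite natrM ler_wpM2r // natrD natrM lerD2l; apply: le_trans sum_le _.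
have C_b : (collisions v)%:R / b <= b * (c0 * m).
  by rewrite ler_pdivrMr //; have -> : b * (c0 * m) * b = b ^+ 2 * (c0 * m) by ring.
have := ler_wpM2l (ltW b0) Dm; lra.
Qed.
End F0Protocol.

(** * Choice of the field and of the constants *)

Theorem theorem1p1 (R : realType) :
  forall c0 : R, 0 < c0 ->
  exists K : R, 0 < K /\
  forall (n alpha : nat) (eps beta : R),
    (0 < n)%N -> (0 < alpha)%N -> 0 < eps -> eps < 1 -> 1 <= beta ->
    exists P : protocol alpha n R,
    forall v : {ffun 'I_alpha -> {set 'I_n}},
      let m := Num.min ((F0 v)%:R) (1 / eps ^+ 2) in
      (collisions v)%:R <= beta * (c0 * m) ->
      @prob R alpha n R P (fun r => approx_out eps (F0 v)%:R (@run alpha n R P v r).1) >= 2 / 3 /\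
      (forall r : {ffun 'I_alpha -> Rnd P},
         (@cost alpha n R P v r)%:R <= K * ((alpha * logn2 n)%:R
                                 + m * Num.sqrt beta * (logn2 n)%:R)).
Proof.
(* Words of [4 * k] bits turn the factors 4 and [3 * 3640 + c0] of the cost into 16 and
   [4 * (3 * 3640 + c0)]. *)
move=> c0 c0_gt0; exists (16 + 4 * (3 * 3640 + c0)); split; first lra.
move=> n alpha eps beta n0 alpha0 eps0 eps1 beta1.
pose k := logn2 n; have [F _ cardF] := pPrimePowerField (isT : prime 2) (isT : (0 < k)%N).
have nF : (n < #|F|)%N by rewrite cardF trunc_log_ltn.
have F2 : (1 < #|F|)%N by apply: leq_ltn_trans nF.
pose iota (x : 'I_n) : F := enum_val (widen_ord (ltnW nF) x).
have iota_inj : injective iota by move=> x y /enum_val_inj/(congr1 val)/= /val_inj.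
have pw := affine_hash_pairwise iota_inj.
(* Two hash seeds of two coefficients each are four field elements of [k] bits. *)
pose W := (4 * k)%N.
have WF : (2 ^ W = #|F| * #|F| * (#|F| * #|F|))%N.
  by rewrite /W cardF -!expnD !addnn -!mul2n mulnA.
have cardT : (#|{: (F * F) * (F * F)}| <= 2 ^ W)%N by rewrite WF !card_prod.
have FW : (#|F|.+1 <= 2 ^ W)%N.
  rewrite WF; move: #|F| F2 => f f2; apply: (@leq_trans (f * f)).
    by rewrite (@leq_trans (2 * f)) ?leq_mul2r ?f2 ?orbT // mul2n -addnn -addn1 leq_add2l ltnW.
  by rewrite leq_pmulr // muln_gt0 ltnW.
have nW : (n < 2 ^ W)%N by apply: (leq_trans nF (ltnW FW)).
exists (f0_protocol W (affine_hash iota) (0, 0) (Ordinal alpha0) eps) => v m Cle.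
split=> [|r].
  exact: (f0_prob (0, 0) (Ordinal alpha0) pw (ltnW nF) cardT FW nW eps0 eps1 v).
have b0 : 0 <= beta by lra.
have sq1 : 1 <= Num.sqrt beta by rewrite -sqrtr1 ler_sqrt.
have Cle' : (collisions v)%:R <= Num.sqrt beta ^+ 2 * (c0 * m) by rewrite sqr_sqrtr.
apply: le_trans (f0_cost cardT FW nW eps0 r sq1 c0_gt0 Cle') _.
have m0 : 0 <= m by rewrite le_min ler0n divr_ge0 // exprn_ge0 // ltW.
rewrite -/k /W !natrM.
have mk : 0 <= m * Num.sqrt beta * k%:R by rewrite !mulr_ge0 // sqrtr_ge0.
have ak : 0 <= alpha%:R * k%:R :> R by rewrite mulr_ge0.
have arith (x y z : R) : 0 <= x * z -> 0 <= y * z -> 0 <= c0 * (x * z) ->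
    (4 * x + y * (3 * 3640 + c0)) * (4 * z)
      <= (16 + 4 * (3 * 3640 + c0)) * (x * z + y * z) by lra.
by apply: arith; rewrite // mulr_ge0 // ltW.
Qed.
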